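(* Let $\mathbb{F}$ be a field of characteristic different from $2$ and $3$, let $V$ be a $2$-dimensional $\mathbb{F}$-vector space, and let $q\colon V\to\mathbb{F}$ be a non-degenerate quadratic form which takes the value $-1$. Let $C_0(-q)$ be the even Clifford algebra of $-q$, with conjugation $x\mapsto\bar{x}$ and Clifford norm $N(x)=x\cdot\bar{x}$. (1) The symmetric bilinear maps $F\colon C_0(-q)\times C_0(-q)\to C_0(-q)$ whose attached quadratic form $q_F$ equals $-N$ are exactly the maps of the form $$F_{ac}(x,y)=a\cdot x\cdot y+c\cdot\overline{x\cdot y},\qquad x,y\in C_0(-q),$$ for some $(a,c)\in C_0(-q)\times C_0(-q)$ with $N(c)-N(a)=1$. (2) Let $G=\{\lambda\in C_0(-q): N(\lambda)=1\}$. Let $(a,c),(a',c')\in C_0(-q)^2$ satisfy $N(c)-N(a)=1$ and $N(c')-N(a')=1$. Then $F_{ac}$ and $F_{a'c'}$ are isomorphic if and only if there exists $\lambda\in G$ such that $(a',c')=(\lambda^{-1}a,\lambda^3c)$ or $(a',c')=(\lambda^{-1}\bar{a},\lambda^3\bar{c})$.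
   Context: Since $q$ is non-degenerate and takes the value $-1$, there is a basis $(v_1,v_2)$ of $V$, orthogonal for the symmetric bilinear form attached to $q$, with $q(v_1)=-1$ and $q(v_2)=-\beta$ for some $\beta\in\mathbb{F}^\ast$. The Clifford algebra $C(-q)$ of $-q$ (in which $v\cdot v=-q(v)$ for $v\in V$) has even part $C_0(-q)=\{x_0+x_{12}(v_1\cdot v_2): x_0,x_{12}\in\mathbb{F}\}$, a commutative $2$-dimensional $\mathbb{F}$-algebra with $(v_1\cdot v_2)^2=-\beta$. Conjugation is $\overline{x_0+x_{12}(v_1\cdot v_2)}=x_0-x_{12}(v_1\cdot v_2)$, and the Clifford norm is $N(x_0+x_{12}(v_1\cdot v_2))=x_0^2+\beta x_{12}^2\in\mathbb{F}$. For a $2$-dimensional $\mathbb{F}$-vector space $W$ and a symmetric bilinear map $F\colon W\times W\to W$, the attached quadratic form $q_F\colon W\to\mathbb{F}$ is $q_F(x)=\det(F_x)$, where $F_x\colon W\to W$ is the endomorphism $F_x(y)=F(x,y)$. Two symmetric bilinear maps $F,F'\colon W\times W\to W$ are isomorphic if there is an $\mathbb{F}$-linear isomorphism $u\colon W\to W$ such that $F'(u(x),u(y))=u(F(x,y))$ for all $x,y\in W$. *)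

(* Defs.v *)
From HB Require Import structures.
From mathcomp Require Import all_boot all_order all_algebra all_field.
From mathcomp Require Import ring.

Set Implicit Arguments.
Unset Strict Implicit.
Unset Printing Implicit Defensive.

Import GRing.Theory.
Local Open Scope ring_scope.

Section QuadraticForms.
Variables (F : fieldType) (V : vectType F).
Implicit Type q : V -> F.

(* When 2 is invertible, [polar q] is twice the symmetric bilinear form b      *)
(* with b v v = q v: both have the same radical and the same orthogonality.    *)
Definition polar q (u v : V) : F := q (u + v) - q u - q v.

Definition quadratic_form q : Prop :=
  (forall (a : F) v, q (a *: v) = a ^+ 2 * q v) /\
  bilinear_for *%R *%R (polar q).

Definition nondegenerate_form q : Prop :=
  forall u, (forall v, polar q u v = 0) -> u = 0.

End QuadraticForms.

Section Clifford.
Variables (F : fieldType) (V : vectType F).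

(* The Clifford algebra of Q, given by its universal property. It is finite    *)
(* dimensional since V is, so nothing is lost by taking C : falgType F.        *)
Definition clifford_algebra (Q : V -> F) (C : falgType F)
    (i : {linear V -> C}) : Prop :=
  (forall v, i v * i v = (Q v)%:A) /\
  (forall (A : algType F) (f : {linear V -> A}),
     (forall v, f v * f v = (Q v)%:A) ->
     exists g : {lrmorphism C -> A},
       (forall v, g (i v) = f v) /\
       (forall g' : {lrmorphism C -> A}, (forall v, g' (i v) = f v) ->
          g' =1 g)).

Variables (C : falgType F) (i : {linear V -> C}).

(* The subalgebra generated by the products of two vectors of V.               *)
Definition even_part : {aspace C} :=
  <<limg (linfun i) * limg (linfun i)>>%AS.

End Clifford.

Notation even_clifford i := (subvs_of (even_part i)).

Section EvenClifford.
Variables (F : fieldType) (V : vectType F) (q : V -> F).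
Variables (C : falgType F) (i : {linear V -> C}).
Local Notation C0 := (even_clifford i).

Definition vec_mul (u v : V) : C0 := vsproj (even_part i) (i u * i v).

(* [vsproj] only changes the type: i u * i v lies in the even part.            *)
Lemma vec_mulE u v : vsval (vec_mul u v) = i u * i v.
Proof.
rewrite vsprojK // -[i u]lfunE -[i v]lfunE.
by apply/(subvP (sub_agenv _))/memv_mul; apply/memv_img/memvf.
Qed.

Definition even_conjugation (conj : C0 -> C0) : Prop :=
  exists v1 v2 : V,
    [/\ basis_of {:V} [:: v1; v2], polar q v1 v2 = 0, q v1 = -1 &
        forall x0 x12 : F,
          conj (x0%:A + x12 *: vec_mul v1 v2) = x0%:A - x12 *: vec_mul v1 v2].

(* x * conj x lies on the line of scalars, which N identifies with F.          *)
Definition clifford_norm (conj : C0 -> C0) (N : C0 -> F) : Prop :=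
  forall x, (N x)%:A = x * conj x.

Definition Fac (conj : C0 -> C0) (a c x y : C0) : C0 :=
  a * x * y + c * conj (x * y).

End EvenClifford.

Section SymmetricBilinearMaps.
Variables (F : fieldType) (W : vectType F).
Implicit Type B : W -> W -> W.

Definition symmetric_bilinear B : Prop :=
  bilinear_for *:%R *:%R B /\ forall x y, B x y = B y x.

Definition lfun_det (f : 'End(W)) : F :=
  \det (passmx.mxof (vbasis {:W}) (vbasis {:W}) f).

(* [linfun (B x)] is the endomorphism B_x only if B x is linear.               *)
Definition attached_form B (x : W) : F := lfun_det (linfun (B x)).

Definition isomorphic_maps B B' : Prop :=
  exists u : {linear W -> W},
    bijective u /\ forall x y, B' (u x) (u y) = u (B x y).

End SymmetricBilinearMaps.

Section Existence.
Variables (F : fieldType) (V : vectType F) (q : V -> F).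
Hypotheses (F2 : (2 \notin [pchar F])%N) (dV : \dim {:V} = 2%N)
  (qq : quadratic_form q) (qn : nondegenerate_form q).

Let two0 : (2%:R : F) != 0.
Proof. by move: F2; rewrite inE. Qed.

Lemma polarC u v : polar q u v = polar q v u.
Proof. by rewrite /polar [u + v]addrC; ring. Qed.

Lemma polarvv v : polar q v v = 2%:R * q v.
Proof.
by rewrite /polar -{1 2}[v]scale1r -scalerDl qq.1; ring.
Qed.

Let pl u a v w : polar q (a *: v + w) u = a * polar q v u + polar q w u.
Proof. exact: (qq.2.1 u a v w). Qed.

Let p0 u : polar q 0 u = 0.
Proof.
have := pl u 1 0 0; rewrite scaler0 addr0 mul1r => /eqP.
by rewrite -[X in X == _]addr0 (inj_eq (addrI _)) eq_sym => /eqP.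
Qed.

Lemma orthogonal_basis_exists : (exists v, q v = -1) ->
  exists v1 v2, [/\ basis_of {:V} [:: v1; v2], polar q v1 v2 = 0,
                    q v1 = -1 & q v2 != 0].
Proof.
case=> v1 q1.
have p11 : polar q v1 v1 = - 2%:R by rewrite polarvv q1; ring.
have [w wN] : exists w, w \notin <[v1]>%VS.
  have : ~~ ({:V} <= <[v1]>)%VS.
    by apply/negP => /dimvS; rewrite dV dim_vline; case: (_ != _).
  by move=> /subvPn [w _ wN]; exists w.
pose v2 := (polar q w v1 / 2%:R) *: v1 + w.
have v2N : v2 \notin <[v1]>%VS.
  apply: contra wN => h.
  have -> : w = v2 - (polar q w v1 / 2%:R) *: v1 by rewrite /v2 [_ + w]addrC addrK.
  by rewrite memvB // memvZ // memv_line.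
have p21 : polar q v2 v1 = 0 by rewrite pl p11; field.
have v10 : v1 != 0.
  apply: contraNneq two0 => v10; move: p11; rewrite v10.
  by rewrite p0 => /eqP; rewrite eq_sym oppr_eq0.
have bas : basis_of {:V} [:: v1; v2].
  rewrite basisEfree subvf dV /= andbT.
  rewrite -[[:: v1; v2]]/([:: v1] ++ [:: v2]).
  rewrite (perm_free (_ : perm_eq _ [:: v2; v1])); last by rewrite (perm_catC [:: v1]).
  by rewrite free_cons span_seq1 v2N seq1_free.
exists v1, v2; split=> //; first by rewrite polarC.
apply: contraNneq v2N => q20.
suff -> : v2 = 0 by rewrite mem0v.
apply: qn => u.
have := coord_basis (bas : basis_of {:V} [tuple v1; v2]) (memvf u).
rewrite big_ord_recl big_ord1 /= => ->.
by rewrite polarC pl polarC p21 mulr0 add0r -[_ *: v2]addr0 pl polarvv q20 !mulr0 p0 addr0.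
Qed.

Local Notation M2 := 'M[F]_2.

Let ord2 (r : 'I_2) : r = 0 \/ r = 1.
Proof. by case: r => [[|[|//]] h]; [left | right]; apply: val_inj. Qed.

Let m2P (A B : M2) : A 0 0 = B 0 0 -> A 0 1 = B 0 1 -> A 1 0 = B 1 0 ->
  A 1 1 = B 1 1 -> A = B.
Proof.
by move=> *; apply/matrixP => r c; case: (ord2 r) => ->; case: (ord2 c) => ->.
Qed.

Let m2M (A B : M2) r c : (A * B) r c = A r 0 * B 0 c + A r 1 * B 1 c.
Proof.
rewrite mxE big_ord_recl big_ord1 /=.
by rewrite (_ : lift ord0 ord0 = 1) //; apply: val_inj.
Qed.

Let det2 (M : M2) : \det M = M 0 0 * M 1 1 - M 0 1 * M 1 0.
Proof.
rewrite (expand_det_row M 0) big_ord_recl big_ord1 /cofactor !det_mx11 !mxE.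
have l01 : lift (0 : 'I_2) (0 : 'I_1) = 1 by apply: val_inj.
have l10 : lift (1 : 'I_2) (0 : 'I_1) = 0 by apply: val_inj.
rewrite l01 l10 /= expr0 expr1.
ring.
Qed.

(* C(-q) is the matrix algebra M_2(F), on which N is the determinant.          *)
Lemma clifford_exists : (exists v, q v = -1) ->
  exists (C : falgType F) (i : {linear V -> C})
         (conj : even_clifford i -> even_clifford i) (N : even_clifford i -> F),
    [/\ clifford_algebra (fun v => - q v) i, even_conjugation q conj
      & clifford_norm conj N].
Proof.
move=> /orthogonal_basis_exists [v1 [v2 [bas p12 q1 q2]]].
pose be := - q v2.
have be0 : be != 0 by rewrite oppr_eq0.
pose X : 2.-tuple V := [tuple v1; v2].
have fX : free X by apply: basis_free bas.
have XE v : v = coord X 0 v *: v1 + coord X 1 v *: v2.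
  have := coord_basis (bas : basis_of {:V} X) (memvf v).
  rewrite big_ord_recl big_ord1 /= (_ : lift ord0 ord0 = 1) //.
  exact: val_inj.
have qE x y : q (x *: v1 + y *: v2) = - x ^+ 2 - be * y ^+ 2.
  have E : polar q (x *: v1) (y *: v2) = 0.
    rewrite -[x *: v1]addr0 pl p0 addr0 polarC -[y *: v2]addr0 pl p0 addr0.
    by rewrite polarC p12 !mulr0.
  have -> : q (x *: v1 + y *: v2) = q (x *: v1) + q (y *: v2).
    by apply/eqP; rewrite -subr_eq0 opprD addrA; apply/eqP.
  by rewrite !qq.1 q1 /be; ring.
pose im (v : V) : M2 := \matrix_(r, c)
  (if r == 0 then if c == 0 then coord X 0 v else be * coord X 1 v
   else if c == 0 then coord X 1 v else - coord X 0 v).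
have im_lin : linear im.
  move=> a u v; apply/matrixP => r c; rewrite !mxE !linearP.
  by case: (r == 0); case: (c == 0) => //=; ring.
pose i : {linear V -> M2} := HB.pack im (GRing.isLinear.Build _ _ _ _ im im_lin).
have iE v : i v = im v by [].
have sq : forall v, i v * i v = (- q v)%:A.
  move=> v; rewrite !iE [in RHS](XE v) qE scalemx1.
  by apply: m2P; rewrite m2M !mxE /= ?mulr1n ?mulr0n; ring.
exists (M2 : falgType F), i.
have iv1 : i v1 = \matrix_(r, c) (if r == c then (-1) ^+ r else 0).
  apply/matrixP => r c; rewrite !mxE.
  have -> : coord X 0 v1 = 1 by rewrite (coord_free 0 0 fX).
  have -> : coord X 1 v1 = 0 by rewrite (coord_free 0 1 fX).
  by case: (ord2 r) => ->; case: (ord2 c) => -> /=; rewrite ?mulr0 ?expr0 ?expr1.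
have iv2 : i v2 = \matrix_(r, c) (if r == c then 0 else if r == 0 then be else 1).
  apply/matrixP => r c; rewrite !mxE.
  have -> : coord X 0 v2 = 0 by rewrite (coord_free 1 0 fX).
  have -> : coord X 1 v2 = 1 by rewrite (coord_free 1 1 fX).
  by case: (ord2 r) => ->; case: (ord2 c) => -> /=; rewrite ?mulr1 ?oppr0.
have univ : clifford_algebra (fun v => - q v) i.
  split=> // A f fsq.
  have f11 : f v1 * f v1 = 1 by rewrite fsq q1 opprK scale1r.
  have f22 : f v2 * f v2 = be%:A by rewrite fsq.
  have f21 : f v2 * f v1 = - (f v1 * f v2).
    have := fsq (v1 + v2); rewrite linearD mulrDl !mulrDr f11 f22.
    have := qE 1 1; rewrite !scale1r => ->.
    rewrite (_ : - (_ - _) = 1 + be); last by ring.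
    rewrite scalerDl scale1r [_ + (be *: 1)]addrC addrACA.
    rewrite -[X in _ = X]addr0 => /addrI /eqP.
    by rewrite addr_eq0 => /eqP ->; rewrite opprK.
  pose c := f v1; pose d := f v2.
  pose T x1 x2 x3 x4 : A := x1 *: 1 + x2 *: c + x3 *: d + x4 *: (c * d).
  have TD x1 x2 x3 x4 y1 y2 y3 y4 :
      T x1 x2 x3 x4 + T y1 y2 y3 y4 = T (x1 + y1) (x2 + y2) (x3 + y3) (x4 + y4).
    rewrite /T !scalerDl addrACA; congr (_ + _).
    by rewrite addrACA; congr (_ + _); rewrite addrACA.
  have TZ a x1 x2 x3 x4 :
      a *: T x1 x2 x3 x4 = T (a * x1) (a * x2) (a * x3) (a * x4).
    by rewrite /T !scalerDr !scalerA.
  have Tc x1 x2 x3 x4 : T x1 x2 x3 x4 * c = T x2 x1 (- x4) (- x3).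
    rewrite /T !mulrDl -!scalerAl mul1r -[c * d * c]mulrA f21 mulrN mulrA f11.
    rewrite mul1r !scalerN !scaleNr [x1 *: _ + _]addrC.
    by rewrite addrAC.
  have Td x1 x2 x3 x4 : T x1 x2 x3 x4 * d = T (be * x3) (be * x4) x1 x2.
    rewrite /T !mulrDl -!scalerAl mul1r -[c * d * d]mulrA f22.
    by rewrite -scalerAr mulr1 !scalerA ![_ * be]mulrC -addrA addrC addrA.
  pose h : F := 2%:R^-1.
  have hE : h * 2%:R = 1 by rewrite mulVf.
  have TM x1 x2 x3 x4 y1 y2 y3 y4 : T x1 x2 x3 x4 * T y1 y2 y3 y4 =
      T (x1 * y1 + x2 * y2 + be * x3 * y3 - be * x4 * y4)
        (x1 * y2 + x2 * y1 - be * x3 * y4 + be * x4 * y3)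
        (x1 * y3 + x3 * y1 + x2 * y4 - x4 * y2)
        (x1 * y4 + x4 * y1 + x2 * y3 - x3 * y2).
    rewrite {2}/T !mulrDr -!scalerAr mulr1 mulrA Tc !Td !TZ !TD.
    by congr T; ring.
  pose g0 (M : M2) := T (h * (M 0 0 + M 1 1)) (h * (M 0 0 - M 1 1))
    (h * (M 0 1 / be + M 1 0)) (h * (M 0 1 / be - M 1 0)).
  have T1 : T 1 0 0 0 = 1 by rewrite /T !scale0r scale1r !addr0.
  have g0l : linear g0.
    by move=> a M M'; rewrite /g0 TZ TD !mxE; congr T; ring.
  have g0m : monoid_morphism g0.
    split; first by rewrite /g0 !mxE /= -T1; congr T;
      rewrite ?mulr1n ?mulr0n ?mul0r ?addr0 ?subrr ?mulr0 // -hE; ring.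
    move=> M M'; rewrite /g0 TM !m2M.
    by congr T; rewrite /h; field; rewrite ?be0 ?two0.
  pose g : {lrmorphism M2 -> A} := HB.pack g0
    (GRing.isLinear.Build _ _ _ _ g0 g0l)
    (GRing.isMonoidMorphism.Build _ _ g0 g0m).
  have giE v : g (i v) = f v.
    rewrite -[LHS]/(g0 (im v)) /g0 !mxE /= [in RHS](XE v) linearD !linearZ /=.
    rewrite -[RHS]addr0 -(scale0r (c * d)) -[X in _ = X + _ + _]add0r -(scale0r 1).
    by congr T; rewrite /h; field; rewrite ?be0 ?two0.
  have uniqT (k : {lrmorphism M2 -> A}) : (forall v, k (i v) = f v) -> k =1 g0.
    move=> ki M.
    rewrite {1}(_ : M = (h * (M 0 0 + M 1 1)) *: 1 + (h * (M 0 0 - M 1 1)) *: i v1 +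
    (h * (M 0 1 / be + M 1 0)) *: i v2
    + (h * (M 0 1 / be - M 1 0)) *: (i v1 * i v2)).
      rewrite !linearD !linearZ /= !rmorphM !rmorph1 !ki.
      by congr (_ + _ *: (_ * _)); apply: ki.
    rewrite iv1 iv2; apply: m2P; rewrite !(mxE, m2M) /= /h;
    rewrite ?mulr1n ?mulr0n ?expr0 ?expr1; by field; rewrite ?be0 ?two0.
  by exists g; split=> // g' /uniqT g'E M; rewrite g'E.
have one0 : 1 \in even_part i by rewrite memvE sub1_agenv.
have id1 : algid (even_part i) = 1 by apply/eqP; rewrite algid_eq1.
have v1E : vsval (1 : even_clifford i) = 1 by rewrite -id1.
exists (fun x => (\tr (vsval x))%:A - x), (fun x => \det (vsval x)); split=> //.
- exists v1, v2; split=> // x y.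
  suff -> : \tr (vsval (x%:A + y *: vec_mul i v1 v2)) = x + x.
    by rewrite scalerDl opprD addrACA subrr add0r.
  have -> : vsval (x%:A + y *: vec_mul i v1 v2) = x%:A + y *: (i v1 * i v2).
    by rewrite -(vec_mulE i) -v1E.
  rewrite iv1 iv2 /mxtrace big_ord_recl big_ord1 (_ : lift ord0 ord0 = 1).
    by rewrite !(mxE, m2M) /= ?mulr1n ?mulr0n ?expr0 ?expr1; ring.
  exact: val_inj.
- move=> x; apply: val_inj.
  rewrite -[LHS]/(\det (vsval x) *: vsval (1 : even_clifford i)) v1E.
  rewrite -[RHS]/(vsval x * vsval ((\tr (vsval x))%:A - x)).
  have -> : vsval ((\tr (vsval x))%:A - x) = (\tr (vsval x))%:A - vsval x.
    by rewrite -v1E.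
  move: (vsval x : M2) => M.
  rewrite det2.
  rewrite /mxtrace big_ord_recl big_ord1 (_ : lift ord0 ord0 = 1).
    by rewrite !scalemx1; apply: m2P; rewrite [RHS]m2M !mxE /= ?mulr1n ?mulr0n; ring.
  exact: val_inj.
Qed.
End Existence.

(* Main.v *)
Require Import Defs.
From HB Require Import structures.
From mathcomp Require Import all_boot all_order all_algebra all_field.
From mathcomp Require Import ring.

Set Implicit Arguments.
Unset Strict Implicit.
Unset Printing Implicit Defensive.

Import GRing.Theory.
Local Open Scope ring_scope.

(** The even Clifford algebra A is spanned by 1 and w = v1 v2, with w^2 = -beta;
    it is commutative, conj is a ring involution of it (conj w = - w), and
    N x = x * conj x is multiplicative. So the argument takes place in an algebra
    with such a w.

    A dimension count suggests, and evaluation at (1,1), (1,w) and (w,w) proves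
    ([symmetric_bilinear_three_term]), that each symmetric bilinear map is
      B(x,y) = a x y + b (x conj y + conj x y) + c conj (x y).
    Then B_x is y |-> p y + r conj y with p = a x + b conj x, r = b x + c conj x,
    whose determinant is N p - N r. Expanding,
      q_B(x) = (N a - N c) N x + tr (k x^2),
    where tr z = z + conj z and k = a conj b - b conj c. The forms N x and
    tr (k x^2) are independent, so q_B = - N means that N c - N a = 1 and k = 0.
    The two equations kill the mixed term:
      b = b (c conj c - a conj a) = c (b conj c) - a (conj a b)
        = c a conj b - a conj b c = 0    ([no_mixed_term]).

    For the second part, an isomorphism u conjugates B_x into B'_(u x), hence
    preserves the attached form, hence N. A linear isometry of N that fixes 1
    sends w to an element of trace 0 and norm N w, that is to w or - w, so that
    u x is l x or l conj x with l = u 1 ([norm_isometry]). As conj l = l^-1,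
    such a u transports F_ac to the map with parameters l^-1 a and l^3 c, with a
    and c conjugated in the second case ([fac_scaled]); and a map F_ac determines
    a and c ([fac_inj]). *)

(** * Determinants of endomorphisms *)

Lemma det2 (R : comNzRingType) (M : 'M[R]_2) :
  \det M = M 0 0 * M 1 1 - M 0 1 * M 1 0.
Proof.
rewrite (expand_det_row M 0) big_ord_recl big_ord1 /cofactor !det_mx11 !mxE.
have -> : lift (0 : 'I_2) (0 : 'I_1) = 1 by apply: val_inj.
have -> : lift (1 : 'I_2) (0 : 'I_1) = 0 by apply: val_inj.
by rewrite /= expr0 expr1 mulN1r mul1r mulrN.
Qed.

Section LfunDet.
Variables (F : fieldType) (W : vectType F).

Lemma linfun_linearE (f : W -> W) : linear f -> linfun f =1 f.
Proof.
move=> fL; pose g : {linear W -> W} := HB.pack f (GRing.isLinear.Build _ _ _ _ f fL).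
by move=> x; rewrite -[f x]/(g x) -[linfun f]/(linfun g) lfunE.
Qed.

(** The determinant may be computed in any basis, also one whose length is
    equal to the dimension only propositionally. *)
Lemma lfun_det_basis n (X : n.-tuple W) (M : 'M[F]_n) (f : 'End(W)) :
  basis_of {:W} X -> (forall i : 'I_n, f X`_i = \sum_j M i j *: X`_j) ->
  lfun_det f = \det M.
Proof.
move=> bX fX; have dn : n = \dim {:W} by rewrite -(size_basis bX).
subst n; have bY := vbasisP {:W}; set Y := vbasis {:W} in bY.
have -> : M = passmx.mxof X X f.
  apply/matrixP => i j; rewrite !mxE /= passmx.vecof_delta fX.
  by rewrite coord_sum_free // (basis_free bX).
have PQ : passmx.mxof X Y \1 *m passmx.mxof Y X \1 = 1%:M.
  rewrite -passmx.mxof_comp // comp_lfun1l passmx.mxof1 //.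
  exact: basis_free bX.
rewrite /lfun_det -/Y -[f in LHS]comp_lfun1l -[f in LHS]comp_lfun1r.
rewrite (passmx.mxof_comp _ _ bX) // (passmx.mxof_comp _ _ bX) // !det_mulmx.
by rewrite mulrC mulrA -det_mulmx PQ det1 mul1r.
Qed.

Lemma lfun_det_comp (f g : 'End(W)) :
  lfun_det (f \o g)%VF = lfun_det f * lfun_det g.
Proof.
by rewrite /lfun_det (passmx.mxof_comp _ _ (vbasisP _)) ?vbasisP // det_mulmx mulrC.
Qed.

Lemma lfun_det1 : lfun_det (\1%VF : 'End(W)) = 1.
Proof. by rewrite /lfun_det passmx.mxof1 ?det1 ?(basis_free (vbasisP _)). Qed.

(** An isomorphism u conjugates B_x into B'_(u x). *)
Lemma attached_form_iso (B B' : W -> W -> W) (u : {linear W -> W}) :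
  (forall x, linear (B x)) -> (forall x, linear (B' x)) -> bijective u ->
  (forall x y, B' (u x) (u y) = u (B x y)) ->
  forall x, attached_form B' (u x) = attached_form B x.
Proof.
move=> lB lB' [v uK vK] uB x.
have lv : linear v.
  by move=> k y z; apply: (can_inj uK); rewrite vK linearP !vK.
have vu : (linfun v \o linfun u)%VF = \1%VF.
  by apply/lfunP => y; rewrite comp_lfunE id_lfunE linfun_linearE // lfunE uK.
have -> : attached_form B' (u x) =
          lfun_det (linfun u \o (linfun (B x) \o linfun v))%VF.
  rewrite /attached_form; congr lfun_det; apply/lfunP => y.
  by rewrite !comp_lfunE lfunE !linfun_linearE // -uB vK.
rewrite lfun_det_comp mulrC lfun_det_comp -mulrA -lfun_det_comp vu.
by rewrite lfun_det1 mulr1.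
Qed.

End LfunDet.

(** * Quadratic algebras with conjugation *)

Section QuadraticAlgebra.
Variables (F : fieldType) (A : falgType F) (w : A) (be : F).
Variables (conj : A -> A) (N : A -> F).
Hypotheses (two0 : 2%:R != 0 :> F) (be0 : be != 0).
Hypothesis ww : w * w = (- be)%:A.
Hypothesis coordP : forall x, exists s t, x = s%:A + t *: w.
Hypothesis conjE : forall s t, conj (s%:A + t *: w) = s%:A - t *: w.
Hypothesis NE : forall x, (N x)%:A = x * conj x.

Lemma quadratic_mulC : commutative (@GRing.mul A).
Proof.
move=> x y; have [s [t ->]] := coordP x.
have yw : w * y = y * w.
  have [a [b ->]] := coordP y.
  by rewrite mulrDl mulrDr -!scalerAl -!scalerAr mul1r mulr1.
by rewrite mulrDl mulrDr -!scalerAl -!scalerAr mul1r mulr1 yw.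
Qed.

(* The same ring as A, with commutativity recorded, so that ring applies. *)
Let R : comNzRingType :=
  HB.pack (Falgebra.sort A) (GRing.PzRing_hasCommutativeMul.Build A quadratic_mulC).
Local Ltac comring :=
  lazymatch goal with |- @eq _ ?x ?y => change (@eq R x y); ring end.
Let algM (s t : F) : (s * t)%:A = s%:A * t%:A :> A := rmorphM (in_alg A) s t.
Let algD (s t : F) : (s + t)%:A = s%:A + t%:A :> A := rmorphD (in_alg A) s t.
Let algN (s : F) : (- s)%:A = - s%:A :> A := rmorphN (in_alg A) s.
Let algE := (algM, algD, algN).
Let wwA : w * w = - be%:A := etrans ww (algN be).
Local Ltac comring_ww :=
  lazymatch goal with |- @eq _ ?x ?y => change (@eq R x y); ring: (wwA : _ = _ :> R) end.

Lemma scalA_inj : injective (fun k : F => k%:A : A).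
Proof. exact: fmorph_inj (in_alg A). Qed.

Lemma double_eq0 (z : A) : z + z = 0 -> z = 0.
Proof.
move/eqP; rewrite -mulr2n -scaler_nat scaler_eq0 (negPf two0) => /eqP.
by [].
Qed.

Lemma conj_scalar s : conj s%:A = s%:A.
Proof. by have := conjE s 0; rewrite scale0r addr0 subr0. Qed.

Lemma conj1 : conj 1 = 1.
Proof. by have := conj_scalar 1; rewrite scale1r. Qed.

Lemma conj_w : conj w = - w.
Proof. by have := conjE 0 1; rewrite scale0r scale1r !add0r. Qed.

Lemma conjD : {morph conj : x y / x + y}.
Proof.
move=> x y; have [s [t ->]] := coordP x; have [a [b ->]] := coordP y.
rewrite addrACA -!scalerDl !conjE addrACA -opprD -!scalerDl //.
Qed.

Lemma conjM : {morph conj : x y / x * y}.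
Proof.
move=> x y; have [s [t ->]] := coordP x; have [a [b ->]] := coordP y.
have mulE c d : (s%:A + c *: w) * (a%:A + d *: w) =
    (s * a - be * (c * d))%:A + (s * d + c * a) *: w.
  rewrite -!(mulr_algl _ w) !algE.
  comring_ww.
rewrite mulE !conjE -!scaleNr mulE; congr (_%:A + _ *: w); ring.
Qed.

Lemma conjK : involutive conj.
Proof.
move=> x; have [s [t ->]] := coordP x.
by rewrite conjE -scaleNr conjE scaleNr opprK.
Qed.

Lemma w_neq0 : w != 0.
Proof.
apply: contraNneq be0 => w0; move: ww; rewrite w0 mul0r => /eqP.
by rewrite eq_sym scaler_eq0 oppr_eq0 oner_eq0 orbF.
Qed.

Lemma w_cancel x : x * w = 0 -> x = 0.
Proof.
move=> xw; have : x * w * w = 0 by rewrite xw mul0r.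
rewrite -mulrA ww -scalerAr mulr1 => /eqP.
by rewrite scaler_eq0 oppr_eq0 (negPf be0) => /eqP.
Qed.

(** Independence of 1 and w comes from conj being a function: on a relation
    s + t w = 0 it gives s - t w = 0 as well. *)
Lemma coord0 s t : s%:A + t *: w = 0 -> s = 0 /\ t = 0.
Proof.
move=> st0; have := conjE s t; rewrite st0 -(scale0r 1) conj_scalar scale0r.
move=> /esym/eqP; rewrite subr_eq0 => /eqP st.
move: (st0); rewrite st => /double_eq0 /eqP.
rewrite scaler_eq0 (negPf w_neq0) orbF => /eqP t0; split=> //.
by move: st; rewrite t0 scale0r => /eqP; rewrite scaler_eq0 oner_eq0 orbF => /eqP.
Qed.

Lemma N_coord s t : N (s%:A + t *: w) = s ^+ 2 + be * t ^+ 2.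
Proof.
apply: scalA_inj; rewrite /= NE conjE.
rewrite -!(mulr_algl _ w) !algE.
comring_ww.
Qed.

Lemma NM : {morph N : x y / x * y}.
Proof.
move=> x y; apply: scalA_inj; rewrite /= NE conjM -scalerA.
transitivity ((N x)%:A * (N y)%:A : A); first by rewrite !NE; comring.
by rewrite -scalerAl mul1r.
Qed.

Lemma N_conj x : N (conj x) = N x.
Proof. by apply: scalA_inj; rewrite /= !NE conjK quadratic_mulC. Qed.

Lemma N1 : N 1 = 1.
Proof. by apply: scalA_inj; rewrite /= NE conj1 mulr1 scale1r. Qed.

Lemma basis_1w : basis_of {:A} [tuple 1; w].
Proof.
rewrite /basis_of free_cons seq1_free w_neq0 andbT.
apply/andP; split.
  apply/eqP/vspaceP => x; rewrite memvf; have [s [t ->]] := coordP x.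
  by rewrite memvD // memvZ // memv_span // !inE eqxx ?orbT.
rewrite span_seq1; apply/negP => /vlineP [k k1].
have [] := @coord0 1 (- k); last by move/eqP; rewrite oner_eq0.
by rewrite scale1r scaleNr -k1 subrr.
Qed.

(** In the basis (1, w) the matrix of y |-> p y + r conj y has rows the
    coordinates of p + r and of (p - r) w. *)
Lemma lfun_det_semilinear (f : 'End(A)) p r :
  (forall x, f x = p * x + r * conj x) -> lfun_det f = N p - N r.
Proof.
have [p0 [p1 ->]] := coordP p; have [r0 [r1 ->]] := coordP r => fE.
pose M : 'M[F]_2 := \matrix_(i, j)
  if i == 0 then if j == 0 then p0 + r0 else p1 + r1
  else if j == 0 then be * (r1 - p1) else p0 - r0.
have o1 : lift ord0 ord0 = 1 :> 'I_2 by apply: val_inj.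
have fM (j : 'I_2) : f [tuple 1; w]`_j = \sum_k M j k *: [tuple 1; w]`_k.
  rewrite fE big_ord_recl big_ord1 o1 !mxE /=.
  case: j => [[|[|//]] ?] /=; rewrite ?conj1 ?conj_w.
    rewrite -!(mulr_algl _ w) !algE; comring.
  rewrite -!(mulr_algl _ w) !algE; comring_ww.
rewrite (lfun_det_basis basis_1w fM) det2 !mxE /= !N_coord; ring.
Qed.

(** * Symmetric bilinear maps and their attached forms *)

Lemma symmetric_bilinear_ext (B B' : A -> A -> A) :
  symmetric_bilinear B -> symmetric_bilinear B' ->
  B 1 1 = B' 1 1 -> B 1 w = B' 1 w -> B w w = B' w w -> B =2 B'.
Proof.
have expand (D : A -> A -> A) s t a b : symmetric_bilinear D ->
    D (s%:A + t *: w) (a%:A + b *: w) =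
    s *: (a *: D 1 1 + b *: D 1 w) + t *: (a *: D 1 w + b *: D w w).
  move=> [[Dl Dr] DC].
  have D0l y : D 0 y = 0.
    by have := Dl y (-1) 0 0; rewrite /= scaler0 addr0 scaleN1r addNr.
  have DZ k x y : D (k *: x) y = k *: D x y.
    by rewrite -[k *: x]addr0 Dl D0l addr0.
  have DD x x' y : D (x + x') y = D x y + D x' y.
    by have := Dl y 1 x x'; rewrite /= !scale1r.
  have row x : D x (a%:A + b *: w) = a *: D x 1 + b *: D x w.
    by rewrite DC DD !DZ (DC 1) (DC w).
  by rewrite DD !DZ !row (DC w 1).
move=> hB hB' h11 h1w hww x y; have [s [t ->]] := coordP x.
by have [a [b ->]] := coordP y; rewrite !expand // h11 h1w hww.
Qed.

Definition three_term_map a b c x y : A :=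
  a * (x * y) + b * (x * conj y + conj x * y) + c * conj (x * y).

Lemma conjZ k x : conj (k *: x) = k *: conj x.
Proof. by rewrite -mulr_algl conjM conj_scalar mulr_algl. Qed.

Lemma conjN x : conj (- x) = - conj x.
Proof. by rewrite -scaleN1r conjZ scaleN1r. Qed.

Lemma three_term_mapC a b c x y : three_term_map a b c x y = three_term_map a b c y x.
Proof.
by rewrite /three_term_map [x * y]quadratic_mulC; congr (_ + _ + _); comring.
Qed.

Lemma three_term_map_linear a b c x : linear (three_term_map a b c x).
Proof.
move=> k y z; rewrite /three_term_map !(mulrDr, conjD, conjZ, scalerDr, mulrDl).
rewrite -!scalerAr !conjZ -!scalerAr; comring.
Qed.

Lemma three_term_map_symmetric_bilinear a b c : symmetric_bilinear (three_term_map a b c).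
Proof.
split; last exact: three_term_mapC.
split=> y; last exact: three_term_map_linear.
by move=> k x z /=; rewrite !(three_term_mapC _ _ _ _ y) three_term_map_linear.
Qed.

(** The values of the three-term map at (1,1), (1,w), (w,w) are a + c + 2 b,
    (a - c) w and (a + c - 2 b) w^2; as 2 and w are invertible, a, b and c can
    be found from them. *)
Lemma symmetric_bilinear_three_term (B : A -> A -> A) :
  symmetric_bilinear B -> exists a b c, B =2 three_term_map a b c.
Proof.
move=> hB; pose h : A := (2%:R^-1)%:A.
(* v is minus the inverse of w, s is a + c and d is c - a. *)
pose v := be^-1 *: w.
have hE : h * 2%:R = 1 by
  rewrite mulr_algl -scaler_nat scalerA mulVf // scale1r.
have wv : w * v = -1 by rewrite -scalerAr ww scalerA mulrN mulVf // scaleN1r.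
pose s := h * (B 1 1 + v * v * B w w); pose d := v * B 1 w.
pose b := h * h * (B 1 1 - v * v * B w w).
pose a := h * (s - d); pose c := h * (s + d).
exists a, b, c; apply: symmetric_bilinear_ext => //.
- exact: three_term_map_symmetric_bilinear.
- transitivity ((h * 2%:R) * (h * 2%:R) * B 1 1); first by rewrite hE !mul1r.
  by rewrite /three_term_map !mulr1 !conj1 ?mulr1 /a /b /c /s /d; comring.
- transitivity ((h * 2%:R) * - (w * v) * B 1 w); first by rewrite hE wv opprK !mul1r.
  by rewrite /three_term_map !mul1r !conj1 conj_w /a /b /c /s /d; comring.
- transitivity ((h * 2%:R) * (h * 2%:R) * (w * v) * (w * v) * B w w).
    by rewrite hE wv -!mulrA !mul1r !mulN1r opprK.
  by rewrite /three_term_map conjM conj_w /a /b /c /s /d; comring.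
Qed.

Lemma attached_form_three_term a b c x :
  let k := a * conj b - b * conj c in
  (attached_form (three_term_map a b c) x)%:A =
    (N a - N c)%:A * (x * conj x) + (k * (x * x) + conj k * conj (x * x)).
Proof.
move=> k; rewrite /attached_form.
rewrite (lfun_det_semilinear (p := a * x + b * conj x) (r := b * x + c * conj x)).
  rewrite !algE /k !NE !(conjD, conjM, conjN, conjK); comring.
move=> y; rewrite (linfun_linearE (three_term_map_linear _ _ _ _)).
rewrite /three_term_map conjM; comring.
Qed.

(** Evaluation at 1 and at w, where N is 1 and beta but x^2 is 1 and - beta,
    separates the norm term from the trace of k; then 1 + w separates k from
    its conjugate. *)
Lemma norm_trace_independent (s k : A) :
  (forall x, s * (x * conj x) + (k * (x * x) + conj k * conj (x * x)) = 0) ->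
  s = 0 /\ k = 0.
Proof.
move=> h.
have h1 : s + (k + conj k) = 0 by have := h 1; rewrite conjM conj1 !mulr1.
have hw : s - (k + conj k) = 0.
  apply: (scalerI be0); rewrite scaler0 -mulr_algl -(h w) conjM conj_w.
  comring_ww.
have s0 : s = 0.
  apply: double_eq0; transitivity (s + (k + conj k) + (s - (k + conj k))).
    by comring.
  by rewrite h1 hw addr0.
split=> //; have kN : conj k = - k.
  by apply/eqP; rewrite -addr_eq0 addrC -h1 s0 add0r.
apply/w_cancel/double_eq0/double_eq0; rewrite -(h (1 + w)).
rewrite s0 kN conjM conjD conj1 conj_w; comring.
Qed.

(** This is a computation, not a cancellation: A may have zero divisors, and
    N b = 0 alone would not give b = 0. *)
Lemma no_mixed_term a b c :
  N c - N a = 1 -> a * conj b = b * conj c -> b = 0.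
Proof.
move=> Nca ab.
have ab' : conj a * b = conj b * c by rewrite -[b in LHS]conjK -conjM ab conjM conjK.
have <- : b * (c * conj c - a * conj a) = b.
  by rewrite -!NE -scalerBl Nca scale1r mulr1.
transitivity (c * (b * conj c) - a * (conj a * b)); first by comring.
by rewrite -ab ab'; comring.
Qed.

(** * Isometries of the norm and isomorphisms *)

(** Dividing u by u 1 reduces to an isometry g with g 1 = 1. Comparing the norms
    of 1 + w and 1 + g w shows that g w has trace 0, so it is a multiple t w,
    and N (t w) = N w forces t = 1 or t = -1. *)
Lemma norm_isometry (u : {linear A -> A}) :
  (forall x, N (u x) = N x) ->
  exists l, N l = 1 /\ (u =1 (fun x => l * x) \/ u =1 (fun x => l * conj x)).
Proof.
move=> uN; pose l := u 1; have Nl : N l = 1 by rewrite uN N1.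
have ll : l * conj l = 1 by rewrite -NE Nl scale1r.
exists l; split=> //.
pose g x := conj l * u x.
have ug x : u x = l * g x by rewrite mulrA ll mul1r.
have gN x : N (g x) = N x by rewrite NM N_conj Nl mul1r uN.
have g1 : g 1 = 1 by rewrite /g quadratic_mulC.
have gD x y : g (x + y) = g x + g y by rewrite /g linearD mulrDr.
have gZ k x : g (k *: x) = k *: g x by rewrite /g linearZ scalerAr.
have zz : g w * conj (g w) = - (w * w) by rewrite -NE gN NE conj_w mulrN.
have tr0 : g w + conj (g w) = 0.
  have := congr1 (fun k => k%:A : A) (gN (1 + w)).
  rewrite !NE !gD g1 !conjD !conj1 conj_w => E.
  transitivity ((1 + g w) * (1 + conj (g w)) - (1 + w) * (1 - w)
    - (g w * conj (g w) + w * w)); first by comring.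
  by rewrite E zz addNr subrr subr0.
have [s [t gw]] := coordP (g w).
have s0 : s%:A = 0 :> A.
  apply: double_eq0; rewrite -tr0 gw conjE; comring.
have {}gw : g w = t *: w by rewrite gw s0 add0r.
have t2 : t ^+ 2 == 1.
  have Nw k : N (k *: w) = be * k ^+ 2.
    by have := N_coord 0 k; rewrite scale0r add0r expr0n add0r.
  have := gN w; rewrite gw -[in RHS](scale1r w) !Nw expr1n.
  by move=> /(mulfI be0) ->.
have gE a b : g (a%:A + b *: w) = a%:A + (b * t) *: w.
  by rewrite gD !gZ g1 gw scalerA.
move: t2; rewrite sqrf_eq1 => /orP[] /eqP t1; [left | right] => x;
  have [a [b ->]] := coordP x; rewrite ug gE t1; congr (_ * _).
  by rewrite mulr1.
by rewrite conjE mulrN1 scaleNr.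
Qed.

Local Notation fac a c := (fun x y => a * x * y + c * conj (x * y)).

Lemma facE a c : fac a c =2 three_term_map a 0 c.
Proof. by move=> x y; rewrite /three_term_map mul0r addr0 mulrA. Qed.

Lemma eq_attached_form (B B' : A -> A -> A) :
  (forall x, linear (B' x)) -> B =2 B' -> attached_form B =1 attached_form B'.
Proof.
move=> B'L BB x; have BL : linear (B x) by move=> k y z; rewrite !BB B'L.
by congr lfun_det; apply/lfunP => y; rewrite !linfun_linearE.
Qed.

Lemma conj0 : conj 0 = 0.
Proof. by have := conj_scalar 0; rewrite scale0r. Qed.

Lemma attached_form_fac a c x :
  attached_form (fac a c) x = (N a - N c) * N x.
Proof.
rewrite (eq_attached_form (three_term_map_linear a 0 c) (facE a c)).
apply: scalA_inj; rewrite /= attached_form_three_term algM NE.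
by rewrite !(conj0, mul0r, mulr0, subr0, addr0).
Qed.

Theorem norm_attached_maps (B : A -> A -> A) :
  (symmetric_bilinear B /\ forall x, attached_form B x = - N x) <->
  (exists a c, N c - N a = 1 /\ B =2 fac a c).
Proof.
split=> [[/symmetric_bilinear_three_term [a [b [c BE]]] BN] | [a [c [Nca BE]]]].
  have [] := @norm_trace_independent (N a - N c + 1)%:A (a * conj b - b * conj c).
    move=> x; have := BN x; rewrite (eq_attached_form (three_term_map_linear a b c) BE).
    move/(congr1 (fun k => k%:A : A)); rewrite attached_form_three_term algN NE.
    move/eqP; rewrite -addr_eq0 => /eqP <-; rewrite [(_ + 1)%:A]algD scale1r.
    comring.
  move/eqP; rewrite scaler_eq0 oner_eq0 orbF => /eqP s0 /eqP; rewrite subr_eq0.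
  move=> /eqP ab; have Nca : N c - N a = 1.
    by rewrite -[RHS]subr0 -s0; ring.
  exists a, c; split=> // x y; rewrite facE BE.
  by rewrite (no_mixed_term Nca ab).
have BE' : B =2 three_term_map a 0 c by move=> x y; rewrite BE facE.
split=> [|x]; last first.
  rewrite (eq_attached_form (three_term_map_linear a 0 c) BE').
  rewrite -(eq_attached_form (three_term_map_linear a 0 c) (facE a c)) attached_form_fac.
  by rewrite -opprB Nca mulN1r.
have [[Dl Dr] DC] := three_term_map_symmetric_bilinear a 0 c.
split=> [|x y]; last by rewrite !BE'.
by split=> y k x z; rewrite !BE'; [exact: Dl | exact: Dr].
Qed.

Lemma fac_inj a c a' c' : fac a c =2 fac a' c' -> a = a' /\ c = c'.
Proof.
move=> E; have := E 1 1; rewrite !mulr1 conj1 !mulr1 => E1.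
have Ew : a - c = a' - c'.
  apply/eqP; rewrite -subr_eq0; apply/eqP/w_cancel.
  have := E 1 w; rewrite !mulr1 !mul1r conj_w !mulrN => /eqP.
  by rewrite -subr_eq0 -!mulrBl => /eqP.
have aa : a = a'.
  apply/eqP; rewrite -subr_eq0; apply/eqP/double_eq0.
  transitivity ((a + c) - (a' + c') + (a - c - (a' - c'))); first by comring.
  by rewrite E1 Ew !subrr addr0.
by split=> //; move: E1; rewrite aa => /addrI.
Qed.

Lemma norm1_inv l : N l = 1 -> l^-1 = conj l.
Proof.
move=> Nl; have ll : l * conj l = 1 by rewrite -NE Nl scale1r.
have lU : l \is a GRing.unit.
  by apply/unitrP; exists (conj l); rewrite quadratic_mulC.
by apply: (mulrI lU); rewrite divrr.
Qed.

(** Since conj l = l^-1, the factor l^2 of the first term of F_a'c' (l x, l y) is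
    l * l, and the factor l^-2 of the second is l * l^-3; by [fac_inj], the
    parameters of the remaining map can be compared with a and c. *)
Lemma fac_scaled a c a' c' l : N l = 1 ->
  (forall x y, fac a' c' (l * x) (l * y) = l * fac a c x y) <->
  (a', c') = (l^-1 * a, l ^+ 3 * c).
Proof.
move=> Nl; have ll : l * conj l = 1 by rewrite -NE Nl scale1r.
have cancel x : conj l * (l * x) = x.
  by rewrite mulrA [conj l * l]quadratic_mulC ll mul1r.
have scaled x y :
    fac a' c' (l * x) (l * y) = l * fac (l * a') (conj l ^+ 3 * c') x y.
  rewrite /= !conjM.
  transitivity (a' * (l * x) * (l * y) +
                l * conj l * c' * (conj l * conj x * (conj l * conj y))).
    by rewrite ll mul1r.
  by comring.
have cube : l ^+ 3 * conj l ^+ 3 = 1.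
  transitivity ((l * conj l) ^+ 3); first by comring.
  by rewrite ll expr1n.
rewrite norm1_inv //; split=> [E | [aE cE] x y].
  have [] := @fac_inj (l * a') (conj l ^+ 3 * c') a c.
    by move=> x y; rewrite -[LHS]cancel -scaled E cancel.
  by move=> <- <-; rewrite cancel mulrA cube mul1r.
have -> : c = conj l ^+ 3 * c'.
  by rewrite cE mulrA [conj l ^+ 3 * _]quadratic_mulC cube mul1r.
by rewrite scaled aE [l * (conj l * a)]mulrA ll mul1r.
Qed.

Theorem fac_isomorphic a c a' c' :
  N c - N a = 1 -> N c' - N a' = 1 ->
  isomorphic_maps (fac a c) (fac a' c') <->
  exists l, N l = 1 /\
    ((a', c') = (l^-1 * a, l ^+ 3 * c) \/
     (a', c') = (l^-1 * conj a, l ^+ 3 * conj c)).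
Proof.
move=> Nca Nca'.
have fac_conj x y : conj (fac a c x y) = fac (conj a) (conj c) (conj x) (conj y).
  by rewrite /= !(conjD, conjM).
split=> [[u [ub uE]] | [l [Nl ac]]].
  have facL d e x : linear (fac d e x).
    by move=> k y z; rewrite !facE three_term_map_linear.
  have uN x : N (u x) = N x.
    have := attached_form_iso (facL _ _) (facL _ _) ub uE x.
    rewrite !attached_form_fac -(opprB (N c)) -(opprB (N c')) Nca Nca' !mulN1r.
    exact: oppr_inj.
  have [l [Nl ul]] := norm_isometry uN; exists l; split=> //.
  case: ul => ul; [left | right]; apply/fac_scaled => // x y.
    by rewrite -!ul uE.
  by rewrite -[x]conjK -[y]conjK -fac_conj -!ul uE.
have ll : l * conj l = 1 by rewrite -NE Nl scale1r.
have ll' : conj l * l = 1 by rewrite quadratic_mulC.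
case: ac => /(fac_scaled _ _ _ _ Nl) E.
  pose u x := l * x.
  have uL : linear u by move=> k x y; rewrite /u mulrDr -scalerAr.
  pose U : {linear A -> A} := HB.pack u (GRing.isLinear.Build _ _ _ _ u uL).
  exists U; split; last exact: E.
  by exists (fun x => conj l * x) => x; rewrite /= /u mulrA ?ll ?ll' mul1r.
pose u x := l * conj x.
have uL : linear u by move=> k x y; rewrite /u conjD conjZ mulrDr -scalerAr.
pose U : {linear A -> A} := HB.pack u (GRing.isLinear.Build _ _ _ _ u uL).
exists U; split=> [|x y].
  exists (fun x => conj (conj l * x)) => x; rewrite /= /u.
    by rewrite mulrA ll' mul1r conjK.
  by rewrite conjK mulrA ll mul1r.
apply: etrans (E (conj x) (conj y)) _.
by rewrite /= /u -fac_conj.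
Qed.

End QuadraticAlgebra.

(** * The even Clifford algebra *)

Lemma span2P (F : fieldType) (U : vectType F) (x y z : U) :
  z \in <<[:: x; y]>>%VS -> exists a b, z = a *: x + b *: y.
Proof.
rewrite span_cons span_seq1 => /memv_addP [_ /vlineP [a ->]].
by move=> [_ /vlineP [b ->] ->]; exists a, b.
Qed.

Section EvenClifford.
Variables (F : fieldType) (V : vectType F) (C : falgType F).
Variables (q : V -> F) (i : {linear V -> C}) (v1 v2 : V).
Hypotheses (iq : forall v, i v * i v = (- q v)%:A) (q1 : q v1 = -1).
Hypotheses (bas : basis_of {:V} [:: v1; v2]) (ort : polar q v1 v2 = 0).

Let e := i v1.
Let f := i v2.
Let be := - q v2.

Lemma clifford_anticomm : f * e = - (e * f).
Proof.
have qD : q (v1 + v2) = q v1 + q v2 by rewrite -[RHS]addr0 -ort /polar; ring.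
have := iq (v1 + v2); rewrite linearD mulrDl !mulrDr !iq qD opprD scalerDl.
rewrite [_ + (- q v2)%:A]addrC addrACA -[X in _ = X]addr0 => /addrI /eqP.
by rewrite addrC addr_eq0 => /eqP.
Qed.

Let ee : e * e = 1. Proof. by rewrite /e iq q1 opprK scale1r. Qed.
Let ff : f * f = be%:A. Proof. exact: iq. Qed.

Lemma bivector_sqr : (e * f) * (e * f) = (- be)%:A.
Proof.
rewrite mulrA -[e * f * e]mulrA clifford_anticomm mulrN mulrA ee mul1r.
by rewrite mulNr ff -scaleNr.
Qed.

(** The span of 1 and v1 v2 contains all products i u * i v and is closed under
    multiplication. *)
Lemma even_part_span : (even_part i <= <<[:: 1%R; (e * f)%R]>>)%VS.
Proof.
set E := <<_>>%VS.
have E1 : 1%R \in E by rewrite memv_span // inE eqxx.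
have Eef : (e * f)%R \in E by rewrite memv_span // !inE eqxx orbT.
apply: agenv_sub_modl.
  by rewrite -memvE.
have VP v : exists a b, v = a *: v1 + b *: v2.
  by apply: span2P; rewrite (span_basis bas) memvf.
have UE : (limg (linfun i) * limg (linfun i) <= E)%VS.
  apply/prodvP => _ _ /memv_imgP [u _ ->] /memv_imgP [v _ ->].
  rewrite !lfunE; have [a [b ->]] := VP u; have [c [d ->]] := VP v.
  rewrite !linearD !linearZ /= mulrDl !mulrDr -!scalerAl -!scalerAr.
  rewrite -/e -/f ee ff clifford_anticomm.
  by rewrite !(memvD, memvZ, memvN).
apply/prodvP => x y /(subvP UE) /span2P [a [b ->]] /span2P [c [d ->]].
rewrite mulrDl !mulrDr -!scalerAl -!scalerAr !mul1r !mulr1 bivector_sqr.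
by rewrite !(memvD, memvZ).
Qed.

Lemma val_even1 : vsval (1 : even_clifford i) = 1.
Proof.
have id1 : algid (even_part i) = 1 by apply/eqP; rewrite algid_eq1 memvE sub1_agenv.
by rewrite -id1.
Qed.

Lemma even_coordP (x : even_clifford i) :
  exists s t, x = s%:A + t *: vec_mul i v1 v2.
Proof.
have /(subvP even_part_span) := subvsP x.
move=> /span2P [a [b xE]]; exists a, b; apply: val_inj.
by rewrite /= xE vec_mulE -val_even1.
Qed.

Lemma vec_mul_sqr : vec_mul i v1 v2 * vec_mul i v1 v2 = (- be)%:A.
Proof.
apply: val_inj; rewrite /= vec_mulE -/e -/f bivector_sqr.
by rewrite -val_even1.
Qed.

End EvenClifford.

Theorem theorem4p2 (F : fieldType) (V : vectType F) (q : V -> F)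
    (C : falgType F) (i : {linear V -> C})
    (conj : even_clifford i -> even_clifford i) (N : even_clifford i -> F) :
  (2 \notin [pchar F])%N -> (3 \notin [pchar F])%N ->
  \dim {:V} = 2%N ->
  quadratic_form q -> nondegenerate_form q -> (exists v, q v = -1) ->
  clifford_algebra (fun v => - q v) i ->
  even_conjugation q conj -> clifford_norm conj N ->
  (forall B : even_clifford i -> even_clifford i -> even_clifford i,
     (symmetric_bilinear B /\ forall x, attached_form B x = - N x) <->
     (exists a c, N c - N a = 1 /\ forall x y, B x y = Fac conj a c x y)) /\
  (forall a c a' c' : even_clifford i,
     N c - N a = 1 -> N c' - N a' = 1 ->
     (isomorphic_maps (Fac conj a c) (Fac conj a' c') <->
      (exists l, N l = 1 /\
         ((a', c') = (l^-1 * a, l ^+ 3 * c) \/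
          (a', c') = (l^-1 * conj a, l ^+ 3 * conj c))))).
Proof.
move=> F2 _ dV qq qn _ [iq _] [v1 [v2 [bas ort q1 conjE]]] NE.
have two0 : 2%:R != 0 :> F by move: F2; rewrite inE.
pose w := vec_mul i v1 v2.
have be0 : - q v2 != 0.
  (* If q v2 = 0 then v2 is in the radical, being orthogonal to v1 and to itself. *)
  have v20 : v2 != 0.
    by apply: (free_not0 (basis_free bas)); rewrite !inE eqxx orbT.
  rewrite oppr_eq0; apply: contraNneq v20 => q20; apply/eqP.
  apply: qn => u; have [a [b ->]] : exists a b, u = a *: v1 + b *: v2.
    by apply: span2P; rewrite (span_basis bas) memvf.
  have Pl k x y : polar q v2 (k *: x + y) = k * polar q v2 x + polar q v2 y.
    exact: (qq.2.2 v2 k x y).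
  have P0 : polar q v2 0 = 0.
    by have := Pl (-1) 0 0; rewrite scaler0 addr0 mulN1r addNr.
  rewrite Pl -[b *: v2]addr0 Pl P0 polarC ort polarvv // q20. ring.
have ww : w * w = (- - q v2)%:A by apply: vec_mul_sqr.
have wP := even_coordP iq q1 bas ort.
split=> [B | a c a' c' Nca Nca'].
  exact: (norm_attached_maps two0 be0 ww wP conjE NE).
exact: (fac_isomorphic two0 be0 ww wP conjE NE Nca Nca').
Qed.
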